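(* Let $r\ge 2$ and $d\ge 3$ be fixed integers. Let $G$ be a $d$-regular $n$-vertex graph with $\lambda(G)\le d-2$. Then $\mathcal{D}_r(G,\mathcal{T}_n)=\Theta_d(n)$; that is, there are constants $c_1,c_2>0$ and $n_0$, depending only on $d$ and $r$, such that every such $G$ with $n\ge n_0$ satisfies $c_1 n\le \mathcal{D}_r(G,\mathcal{T}_n)\le c_2 n$.
   Context: Graphs are finite and simple. $\lambda(G)$ denotes the second largest eigenvalue (counted with multiplicity) of the adjacency matrix of $G$. Spanning-tree discrepancy: for a connected $n$-vertex graph $G$, an $r$-colouring $f:E(G)\to[r]$ of its edges, and a spanning tree $T$ of $G$ (which has $n-1$ edges), put $D_f(T) := r\cdot\left(\max_{1\le i\le r}|f^{-1}(i)\cap E(T)| - \frac{n-1}{r}\right)$. The $r$-colour spanning-tree discrepancy of $G$ is $\mathcal{D}_r(G,\mathcal{T}_n) := \min_{f:E(G)\to[r]}\ \max_{T} D_f(T)$, where the maximum is over all spanning trees $T$ of $G$. *)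

(* Defs.v *)
From mathcomp Require Import all_boot all_order all_algebra.
From mathcomp Require Import polyrcf.
From mathcomp Require Import classical_sets reals.

Set Implicit Arguments.
Unset Strict Implicit.
Unset Printing Implicit Defensive.

Import Order.TTheory GRing.Theory Num.Theory.
Local Open Scope ring_scope.

Record sgraph (V : finType) := SGraph {
  adj :> rel V;
  adj_sym : symmetric adj;
  adj_irr : irreflexive adj }.

Section Graphs.
Variable V : finType.
Implicit Types G T : sgraph V.

Definition edges G : {set {set V}} :=
  [set A | [exists x, exists y, G x y && (A == [set x; y])]].

Definition edge G := {A : {set V} | A \in edges G}.

Definition regular G (d : nat) := forall x, #|[set y | G x y]| = d.

Definition connected_graph G := forall x y, connect G x y.

(* A ucycle of size 2 is a single edge traversed back and forth; irreflexivity
   excludes size 1. *)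
Definition acyclic G := forall c : seq V, ucycle G c -> (size c <= 2)%N.

Definition is_tree G := connected_graph G /\ acyclic G.

(* T has the same vertex type as G, so it spans. *)
Definition spanning_tree G T := subrel T G /\ is_tree T.

End Graphs.

Section Spectrum.
Variable R : realType.

Definition adjmx (V : finType) (G : sgraph V) : 'M[R]_#|V| :=
  \matrix_(i, j) (G (enum_val i) (enum_val j))%:R.

(* The real eigenvalues in non-increasing order, each repeated according to
   its multiplicity as a root of the characteristic polynomial. *)
Definition eigenvalues n (A : 'M[R]_n) : seq R :=
  sort >=%R (flatten [seq nseq (mup x (char_poly A)) x
                     | x <- rootsR (char_poly A)]).

(* The default value 0 is only reached when G has fewer than two vertices. *)
Definition lambda2 (V : finType) (G : sgraph V) : R :=
  nth 0 (eigenvalues (adjmx G)) 1.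

End Spectrum.

Section Discrepancy.
Variables (R : realType) (V : finType) (G : sgraph V) (r : nat).
Local Open Scope classical_set_scope.

Definition tree_disc (f : {ffun edge G -> 'I_r}) (T : sgraph V) : R :=
  r%:R * ((\max_(i < r)
             #|[set e : edge G | (f e == i) && (val e \in edges T)]%SET|)%:R
          - (#|V|%:R - 1) / r%:R).

(* Both the sup and the inf range over finite sets of values, nonempty as soon
   as G is connected and r > 0, so they are a maximum and a minimum. *)
Definition discrepancy : R :=
  inf [set sup [set tree_disc f T | T in spanning_tree G]
      | f in [set: {ffun edge G -> 'I_r}]].

End Discrepancy.

(* Main.v *)
(* Let G_i be the graph of the edges of colour i.  A spanning forest of G_i extends to
   a spanning tree of G, so the largest number of edges of colour i in a spanning tree
   is rank(G_i) = n - #components(G_i), and it suffices to show that the ranks sum to at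
   least (1 + c) n.  The Rayleigh quotient on the orthogonal of the constants turns
   lambda_2 <= d - 2 into e(S, S^c) >= 2 |S| |S^c| / n for all S.

   If some monochromatic component has at least 3n/4 vertices, its rank is large enough.
   Otherwise call a vertex mixed if it meets at least two colours.  By expansion, every
   nontrivial monochromatic component C has at least three mixed vertices unless all its
   vertices are mixed.  Distributing 6 (|C| - 1) over the vertices of C, with 6 for an
   unmixed vertex and, for a mixed vertex, 4 if |C| > 2 and 3 if |C| = 2, every vertex
   receives at least 6 in total, and at least 7 if it is mixed: it meets three colours, or
   two colours of which one has degree at least 2 there.  So the ranks sum to at least
   n + #mixed / 6.  Finally a component C has at least |C| / (2d) mixed vertices, since
   only these carry edges leaving C, hence n <= 2 d r #mixed. *)

Require Import Defs.
From mathcomp Require Import boolp classical_sets reals.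
From mathcomp Require Import all_boot all_order all_algebra.
From mathcomp Require Import polyrcf zify lra.

Set Implicit Arguments.
Unset Strict Implicit.
Unset Printing Implicit Defensive.

Import Order.TTheory GRing.Theory Num.Theory.
Local Open Scope ring_scope.

(** * Rayleigh quotients of symmetric matrices *)

Section RayleighQuotient.
Variables (R : realType) (n : nat).
Implicit Types (A B : 'M[R]_n) (x y : 'rV[R]_n).

Definition bform A x y : R := (x *m A *m y^T) 0 0.

Definition sqnorm x : R := (x *m x^T) 0 0.

Lemma sqnormE x : sqnorm x = \sum_j x 0 j ^+ 2.
Proof. by rewrite /sqnorm mxE; apply: eq_bigr => j _; rewrite !mxE expr2. Qed.

Lemma sqnorm_ge0 x : 0 <= sqnorm x.
Proof. by rewrite sqnormE sumr_ge0 // => j _; rewrite sqr_ge0. Qed.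

Lemma sqnorm_gt0 x : x != 0 -> 0 < sqnorm x.
Proof.
move=> x0; rewrite lt_neqAle sqnorm_ge0 andbT eq_sym.
apply: contra x0; rewrite sqnormE psumr_eq0; last by move=> j _; rewrite sqr_ge0.
move=> /allP x0; apply/eqP/rowP => j; rewrite mxE.
by have := x0 j (mem_index_enum _); rewrite sqrf_eq0 => /eqP.
Qed.

Lemma bformC A x y : A^T = A -> bform A x y = bform A y x.
Proof.
move=> sA; transitivity ((x *m A *m y^T)^T 0 0); first by rewrite [RHS]mxE.
by rewrite !trmx_mul trmxK sA mulmxA.
Qed.

Lemma bform_sqrB A t x y : A^T = A -> bform A (x - t *: y) (x - t *: y) =
  bform A x x - 2 * t * bform A x y + t ^+ 2 * bform A y y.
Proof.
move=> sA; have yx : bform A y x = bform A x y by exact: bformC.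
have trE : (x - t *: y)^T = x^T - t *: y^T by apply/matrixP => i j; rewrite !mxE.
rewrite /bform trE !mulmxBl !mulmxBr -!scalemxAl -!scalemxAr; move: yx.
rewrite /bform; move: (x *m A *m x^T) (x *m A *m y^T) (y *m A *m x^T) (y *m A *m y^T).
by move=> m1 m2 m3 m4 e; rewrite !mxE e; lra.
Qed.

(** Each [x 0 i * y 0 j] is at most the mean of the two squared norms in absolute value. This crude
    bound is applied both to [A] and, below, to the inverse of [sup E - A]. *)
Lemma bform_le_sqnorm A x y :
  bform A x y <= (\sum_i \sum_j `|A i j|) * ((sqnorm x + sqnorm y) / 2).
Proof.
have le1 (z : 'rV[R]_n) i : z 0 i ^+ 2 <= sqnorm z.
  rewrite sqnormE (bigD1 i) //= lerDl sumr_ge0 // => j _; exact: sqr_ge0.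
rewrite /bform mxE exchange_big /= mulr_suml ler_sum // => j _.
rewrite !mxE !mulr_suml ler_sum // => i _.
rewrite (le_trans (ler_norm _)) // !normrM mulrAC mulrC ler_wpM2l //.
have := le1 x i; have := le1 y j; rewrite -(real_normK (num_real (x 0 i))).
rewrite -(real_normK (num_real (y 0 j))).
have := sqr_ge0 (`|x 0 i| - `|y 0 j|); nra.
Qed.

(** The eigenvalue is the supremum of the Rayleigh quotients. Proving [(sup E)%:M - A] singular
    replaces a compactness argument for a maximiser. *)
Lemma sym_max_eigenvalue A : (0 < n)%N -> A^T = A ->
  exists s, eigenvalue A s /\ forall x, bform A x x <= s * sqnorm x.
Proof.
move=> n0 sA; pose c M : R := \sum_i \sum_j `|(M : 'M[R]_n) i j|.
pose E : set R := [set q | exists2 x, x != 0 & q = bform A x x / sqnorm x]%classic.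
have ubE : ubound E (c A).
  move=> _ [x x0 ->]; rewrite ler_pdivrMr ?sqnorm_gt0 //.
  by have := bform_le_sqnorm A x x; rewrite /c; set k := \sum_i _; lra.
have neE : (E !=set0)%classic.
  have x0 : const_mx 1 != 0 :> 'rV[R]_n.
    apply/eqP => /rowP /(_ (Ordinal n0)); rewrite !mxE => /eqP.
    by rewrite oner_eq0.
  by exists (bform A (const_mx 1) (const_mx 1) / sqnorm (const_mx 1)); exists (const_mx 1).
have supE x : bform A x x <= sup E * sqnorm x.
  have [->|x0] := eqVneq x 0.
    by rewrite /bform /sqnorm !mul0mx mxE mulr0.
  rewrite -ler_pdivrMr ?sqnorm_gt0 //; apply: ub_le_sup; first by exists (c A).
  by exists x.
exists (sup E); split=> //; pose B := (sup E)%:M - A.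
have BE x y : bform B x y = sup E * (x *m y^T) 0 0 - bform A x y.
  by rewrite /bform /B mulmxBr mulmxBl mul_mx_scalar -scalemxAl !mxE.
have sB : B^T = B by rewrite /B linearB /= tr_scalar_mx sA.
have [uB|] := boolP (B \in unitmx); last first.
  move=> nuB; suff: kermx B != 0.
    move/rowV0Pn => [v /sub_kermxP vB v0]; apply/eigenvalueP; exists v => //.
    apply/eqP; rewrite eq_sym -subr_eq0 -mul_mx_scalar -mulmxBr.
    by apply/eqP.
  by rewrite kermx_eq0 row_free_unit.
(* If B = sup - A were invertible it would be positive definite with a gap:
   expand the form of B at x - x B^-1 / k, k a bound for the form of B^-1. *)
have k0 : 0 < c (invmx B) + 1.
  by rewrite ltr_wpDl // sumr_ge0 // => i _; rewrite sumr_ge0.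
set k := c _ + 1 in k0.
have gap x : sqnorm x / k <= bform B x x.
  pose y := x *m invmx B.
  have yB : y *m B = x by rewrite /y mulmxKV.
  have xBy : bform B x y = sqnorm x by rewrite bformC // /bform yB.
  have yBy : bform B y y <= k * sqnorm x.
    rewrite /bform yB -/(bform _ _ _).
    have -> : (x *m y^T) 0 0 = bform (invmx B) x x.
      transitivity ((x *m y^T)^T 0 0); first by rewrite [RHS]mxE.
      by rewrite trmx_mul trmxK.
    have := bform_le_sqnorm (invmx B) x x; have := sqnorm_ge0 x.
    by rewrite -/(c _) /k; set q := c _; lra.
  have : 0 <= bform B (x - k^-1 *: y) (x - k^-1 *: y).
    by rewrite BE subr_ge0 -/(sqnorm _).
  rewrite bform_sqrB // xBy => h.
  have : k^-1 ^+ 2 * bform B y y <= k^-1 * sqnorm x.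
    rewrite (le_trans (ler_wpM2l (sqr_ge0 _) yBy)) // mulrA expr2 -[k^-1 * _ * k]mulrA.
    by rewrite mulVf ?mulr1 // gt_eqF.
  by move: h; rewrite [sqnorm x / k]mulrC; lra.
(* The gap makes [sup E - k^-1] an upper bound of the quotients, below their supremum. *)
suff: sup E <= sup E - k^-1 by rewrite lerBDr gerDl leNgt invr_gt0 k0.
apply: ge_sup => // _ [x x0 ->]; rewrite ler_pdivrMr ?sqnorm_gt0 //.
have := gap x; rewrite BE -/(sqnorm x); lra.
Qed.

End RayleighQuotient.

(** * Multiplicities of eigenvalues *)

Section Spectrum.

(** The rows of [W] span an invariant subspace on which [A] acts as [D]. Completing them to a basis,
    the rows of [E], conjugates [A] to a block triangular matrix with diagonal block [D]. *)
Lemma char_poly_invariant_dvdp (F : fieldType) k n (A : 'M[F]_n) (D : 'M_k)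
    (W : 'M_(k, n)) :
  row_free W -> W *m A = D *m W -> char_poly D %| char_poly A.
Proof.
move=> frW; have kn : (k <= n)%N by rewrite -(eqP frW) rank_leq_col.
have [m en] : exists m, n = (k + m)%N by exists (n - k)%N; rewrite subnKC.
subst n => WA; pose E := block_mx (col_ebase W) 0 0 1%:M *m row_ebase W.
have uE : E \in unitmx.
  rewrite unitmx_mul row_ebase_unit andbT unitmxE det_ublock det1 mulr1.
  by rewrite -unitmxE col_ebase_unit.
have EW : usubmx E = W.
  rewrite /E -mul_usub_mx block_mxEv col_mxKu -[RHS]mulmx_ebase (eqP frW).
  by rewrite pid_mx_row mul_mx_row mulmx1 mulmx0.
clearbody E; pose G := E *m A *m invmx E.
have GE : G = block_mx D 0 (dlsubmx G) (drsubmx G).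
  rewrite -[LHS]vsubmxK block_mxEv; congr col_mx; last by rewrite hsubmxK.
  rewrite /G -!mul_usub_mx EW WA -EW -mulmxA mul_usub_mx mulmxV //.
  rewrite scalar_mx_block.
  by rewrite block_mxEv col_mxKu mul_mx_row mulmx1 mulmx0.
have -> : char_poly A = char_poly G.
  pose Ep := map_mx polyC E.
  have dE : \det Ep != 0.
    by rewrite det_map_mx polyC_eq0 -unitfE -unitmxE.
  apply: (mulIf dE); rewrite /char_poly mulrC -!det_mulmx; congr (\det _).
  rewrite /char_poly_mx mulmxBr mulmxBl -!map_mxM /G mulmxKV //.
  by rewrite mul_mx_scalar mul_scalar_mx.
rewrite GE /char_poly /char_poly_mx map_block_mx /= map_mx0 scalar_mx_block.
by rewrite opp_block_mx add_block_mx oppr0 addr0 det_lblock dvdp_mulr.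
Qed.

Variable R : realType.

Lemma count_mem_eigenvalues n (A : 'M[R]_n) a :
  count_mem a (eigenvalues A) = mup a (char_poly A).
Proof.
rewrite /eigenvalues; set p := char_poly A.
have p0 : p != 0 by exact/monic_neq0/char_poly_monic.
have [x_r|x_r] := boolP (a \in rootsR p); last first.
  rewrite mupNroot; last first.
    by have /(_ a) := roots_on_rootsR p0; rewrite (negPf x_r) inE /= => ->.
  apply/count_memPn; rewrite mem_sort; apply/negP => /flatten_mapP [y y_r].
  by move=> /nseqP [ay _]; rewrite ay y_r in x_r.
have /permP -> : perm_eq (sort >=%R (flatten [seq nseq (mup x p) x | x <- rootsR p]))
  (flatten [seq nseq (mup x p) x | x <- rootsR p]) by rewrite perm_sort.
rewrite count_flatten -map_comp sumnE big_map (bigD1_seq a) ?uniq_roots //=.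
rewrite count_nseq /= eqxx mul1n big1 ?addn0 // => y ya.
by rewrite count_nseq /= (negPf ya).
Qed.

(** The two factors yield two entries above [m] in the list, through the multiplicity when [a = b].
    As the list is non-increasing, its entry at index 1 is one of those above [m]. *)
Lemma lt_second_eigenvalue n (A : 'M[R]_n) (m a b : R) :
  m < a -> m < b -> ('X - a%:P) * ('X - b%:P) %| char_poly A ->
  m < nth 0 (eigenvalues A) 1.
Proof.
move=> ma mb abA; set p := char_poly A in abA.
have p0 : p != 0 by exact/monic_neq0/char_poly_monic.
have : (2 <= count (> m) (eigenvalues A))%N.
  have [ab|ab] := eqVneq a b.
    rewrite -{b mb}ab in abA.
    have : (2 <= count_mem a (eigenvalues A))%N.
      by rewrite count_mem_eigenvalues mup_geq.
    by move=> /leq_trans; apply; apply: sub_count => x /eqP ->.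
  have mem x : 'X - x%:P %| p -> (0 < count_mem x (eigenvalues A))%N.
    by rewrite count_mem_eigenvalues XsubC_dvd.
  have ha : (0 < count_mem a (eigenvalues A))%N.
    by apply: mem; apply: dvdp_trans abA; rewrite dvdp_mulr.
  have hb : (0 < count_mem b (eigenvalues A))%N.
    by apply: mem; apply: dvdp_trans abA; rewrite dvdp_mull.
  apply: (@leq_trans (count (predU (pred1 a) (pred1 b)) (eigenvalues A))).
    have := count_predUI (pred1 a) (pred1 b) (eigenvalues A).
    rewrite [X in (_ + X)%N](_ : _ = 0%N); first by lia.
    rewrite -(@count_pred0 _ (eigenvalues A)); apply: eq_count => x /=.
    by apply/negP => /andP [/eqP -> /eqP]; exact/eqP.
  by apply: sub_count => x /= /orP [] /eqP ->.
have : sorted >=%R (eigenvalues A) by apply: sort_sorted => x y; exact: ge_total.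
case: (eigenvalues A) => [|x [|y s]] //=; first by rewrite addn0; case: (_ < _).
move=> /andP [_ ys] h; rewrite ltNge; apply/negP => ym.
suff : count (> m) s = 0%N by move=> s0; move: h; rewrite s0 [m < y]ltNge ym; case: (_ < _).
apply/eqP; rewrite -leqn0 leqNgt -has_count; apply/hasP => -[z zs /= mz].
have ge_trans : transitive (>=%R : rel R) by move=> u v w vu wv; exact: le_trans wv vu.
have /allP /(_ z zs) /= zy := order_path_min ge_trans ys.
by have := lt_le_trans mz (le_trans zy ym); rewrite ltxx.
Qed.

End Spectrum.

(** A case of the Courant-Fischer principle. The test vector [x] forces an eigenvector [v]
    orthogonal to [u] with eigenvalue above [m]; the action of [A] on the span of [u] and [v] then
    contributes two roots above [m]. *)
Lemma lt_second_eigenvalue_rayleigh (R : realType) n (A : 'M[R]_n) (u x : 'rV_n)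
    (d m : R) :
  A^T = A -> u != 0 -> u *m A = d *: u -> m < d ->
  x *m u^T = 0 -> m * sqnorm x < bform A x x ->
  m < nth 0 (eigenvalues A) 1.
Proof.
move=> sA u0 uA md xu mx.
have n0 : (0 < n)%N by case: (n) u u0 {A x sA uA xu mx} => // u; rewrite [u]thinmx0 eqxx.
have uu : u *m u^T = (sqnorm u)%:M by rewrite /sqnorm [LHS]mx11_scalar.
have su := sqnorm_gt0 u0.
(* Deflation moves the eigenvalue of u down to m, so that a maximal eigenvector
   of M, whose eigenvalue exceeds m, is orthogonal to u. *)
pose c := (d - m) / sqnorm u; pose M := A - c *: (u^T *m u).
have sM : M^T = M.
  by rewrite /M linearB /= linearZ /= trmx_mul trmxK sA.
have [s [/eigenvalueP [v vM v0] maxs]] := sym_max_eigenvalue n0 sM.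
have ms : m < s.
  have : bform M x x = bform A x x.
    rewrite /bform /M mulmxBr -scalemxAr mulmxA xu mul0mx scaler0 subr0.
    by [].
  have := maxs x; have := sqnorm_ge0 x; set q := sqnorm x.
  move=> q0 h e; rewrite ltNge; apply/negP => sm.
  by have := ler_wpM2r q0 sm; move: mx; rewrite -/q; lra.
have Au : A *m u^T = d *: u^T.
  by rewrite -{1}sA -trmx_mul uA linearZ.
have Mu : M *m u^T = m *: u^T.
  rewrite /M mulmxBl Au -scalemxAl -mulmxA uu mul_mx_scalar scalerA -scalerBl.
  by congr (_ *: _); rewrite /c mulfVK ?gt_eqF // subKr.
have vu : v *m u^T = 0.
  have : (s - m) *: (v *m u^T) = 0.
    by rewrite scalerBl scalemxAl -vM -mulmxA Mu -scalemxAr subrr.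
  by move/eqP; rewrite scaler_eq0 subr_eq0 (gt_eqF ms) => /eqP.
have vA : v *m A = s *: v.
  by rewrite -vM /M mulmxBr -scalemxAr mulmxA vu mul0mx scaler0 subr0.
pose W : 'M_(1 + 1, n) := col_mx u v.
have frW : row_free W.
  apply: inj_row_free => z; rewrite -[z]hsubmxK mul_row_col.
  move: (lsubmx z) (rsubmx z) => a b ab.
  have a0 : a = 0.
    have := congr1 (mulmx^~ u^T) ab; rewrite /= mulmxDl -!mulmxA vu mulmx0 addr0 mul0mx.
    rewrite uu mul_mx_scalar => /eqP; rewrite scaler_eq0 (gt_eqF su) => /eqP //.
  move: ab; rewrite a0 mul0mx add0r [b]mx11_scalar mul_scalar_mx => /eqP.
  by rewrite scaler_eq0 (negPf v0) orbF => /eqP ->; rewrite -scalemx1 scale0r row_mx0.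
have WA : W *m A = block_mx d%:M 0 0 s%:M *m W.
  by rewrite mul_col_mx mul_block_col uA vA !mul0mx addr0 add0r !mul_scalar_mx.
have := char_poly_invariant_dvdp frW WA.
rewrite {1}/char_poly char_block_diag_mx det_lblock -!/(char_poly _).
have ch a : char_poly (a%:M : 'M[R]_1) = 'X - a%:P.
  by rewrite char_poly_trig ?scalar_mx_is_trig // big_ord1 mxE eqxx mulr1n.
by rewrite !ch; exact: lt_second_eigenvalue.
Qed.

(** * Edge expansion from the second eigenvalue *)

Section Expansion.
Variables (R : realType) (V : finType) (G : sgraph V) (d : nat).
Hypothesis Gd : regular G d.

Definition cut (S : {set V}) : nat := \sum_(x in S) #|[set y | G x y && (y \notin S)]|.

Lemma cut_add_inner (S : {set V}) :
  (cut S + \sum_(x in S) #|[set y | G x y && (y \in S)]| = d * #|S|)%N.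
Proof.
rewrite -big_split /= mulnC -sum_nat_const; apply: eq_bigr => x _.
rewrite -(Gd x) -(cardsID S [set y | G x y]) addnC; congr (_ + _)%N;
  by apply: eq_card => y; rewrite !inE // andbC.
Qed.

(** Write s for [#|S|]. The test vector is the indicator of [S] minus its projection on the
    constants: its squared norm is s(n - s)/n, and its form is d times that minus [cut S]. A smaller
    cut would give a Rayleigh quotient above d - 2. *)
Lemma expansion (S : {set V}) : lambda2 R G <= d%:R - 2 ->
  (2 * #|S| * (#|V| - #|S|) <= #|V| * cut S)%N.
Proof.
rewrite /lambda2; set A := adjmx R G; set n := #|V| => l2.
have [V0|n0] := posnP n.
  have : (#|S| <= n)%N by exact: max_card.
  by rewrite V0 leqn0 => /eqP ->; rewrite muln0.
have sA : A^T = A by apply/matrixP => i j; rewrite !mxE adj_sym.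
pose u : 'rV[R]_n := const_mx 1; pose ind : 'rV[R]_n := \row_j (enum_val j \in S)%:R.
have sumE (F : V -> R) : \sum_(j < n) F (enum_val j) = \sum_v F v.
  rewrite [RHS](reindex (@enum_val V predT)) //.
  by exists enum_rank => i _; rewrite ?enum_valK ?enum_rankK.
have card1 (P : pred V) : \sum_v (P v)%:R = #|[set v | P v]|%:R :> R.
  rewrite -natr_sum -sum1_card [in RHS]big_mkcond; congr (_%:R).
  by apply: eq_bigr => v _; rewrite inE; case: (P v).
have u0 : u != 0.
  by apply/eqP => /rowP /(_ (Ordinal n0)); rewrite !mxE => /eqP; rewrite oner_eq0.
have uA : u *m A = d%:R *: u.
  apply/rowP => j; rewrite !mxE -{1}[d](Gd (enum_val j)) mulr1 -card1 -sumE.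
  by apply: eq_bigr => i _; rewrite !mxE mul1r adj_sym.
pose s : R := #|S|%:R.
have uu : u *m u^T = n%:R%:M.
  rewrite [LHS]mx11_scalar; congr _%:M; rewrite mxE.
  rewrite (eq_bigr (fun=> 1)) ?sumr_const ?card_ord // => j _.
  by rewrite !mxE mulr1.
have iu : ind *m u^T = s%:M.
  rewrite [LHS]mx11_scalar; congr _%:M; rewrite mxE.
  rewrite (eq_bigr (fun j => (enum_val j \in S)%:R)); last by move=> j _; rewrite !mxE mulr1.
  by rewrite (sumE (fun v => (v \in S)%:R)) card1 cardsE.
have ii : sqnorm ind = s.
  rewrite sqnormE (eq_bigr (fun j => (enum_val j \in S)%:R)); last first.
    by move=> j _; rewrite mxE -natrX; case: (_ \in S).
  by rewrite (sumE (fun v => (v \in S)%:R)) card1 cardsE.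
have AI : bform A ind ind = d%:R * s - (cut S)%:R.
  rewrite -natrM -cut_add_inner natrD addrC addKr natr_sum /bform mxE.
  rewrite [RHS]big_mkcond -sumE; apply: eq_bigr => j _; rewrite !mxE.
  rewrite mulrC; case: (enum_val j \in S); rewrite ?mul0r ?mul1r //.
  rewrite -card1 -sumE; apply: eq_bigr => i _; rewrite !mxE adj_sym.
  by case: (G _ _); rewrite ?mulr0 ?mulr1.
have n0' : 0 < n%:R :> R by rewrite ltr0n.
pose t : R := s / n%:R; have tn : t * n%:R = s by rewrite /t mulfVK ?gt_eqF.
pose x := ind - t *: u.
have xu : x *m u^T = 0.
  rewrite mulmxBl iu -scalemxAl uu -[n%:R%:M]scalemx1 scalerA scalemx1.
  by rewrite tn subrr.
have Aiu : bform A ind u = d%:R * s.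
  rewrite bformC // /bform uA -scalemxAl mxE.
  by rewrite -[u *m _]trmxK trmx_mul trmxK iu tr_scalar_mx mxE mulr1n.
have Auu : bform A u u = d%:R * n%:R.
  by rewrite /bform uA -scalemxAl uu !mxE mulr1n.
have xx : sqnorm x = s - t * s.
  have -> : sqnorm x = bform 1%:M x x by rewrite /bform mulmx1.
  rewrite bform_sqrB ?tr_scalar_mx // /bform !mulmx1 iu uu -/(sqnorm _) ii !mxE !mulr1n.
  by rewrite expr2 -[t * t * _]mulrA tn; lra.
have Axx : bform A x x = d%:R * s - (cut S)%:R - t * d%:R * s.
  by have := congr1 ( *%R (d%:R * t)) tn; rewrite bform_sqrB // AI Aiu Auu /=; lra.
rewrite leqNgt; apply/negP => lt_cut.
have dn : d%:R - 2 < d%:R :> R by lra.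
suff: (d%:R - 2) * sqnorm x < bform A x x.
  move=> /(lt_second_eigenvalue_rayleigh sA u0 uA dn xu) lt2.
  by have := lt_le_trans lt2 l2; rewrite ltxx.
rewrite xx Axx.
have : n%:R * (cut S)%:R < 2 * s * (n%:R - s) :> R.
  by rewrite /s -natrB ?max_card // -!natrM ltr_nat.
have -> : 2 * s * (n%:R - s) = n%:R * (2 * (s - t * s)) by rewrite -tn; lra.
by rewrite ltr_pM2l //; lra.
Qed.

End Expansion.

(** * Spanning trees *)

Section SpanningTrees.
Variable V : finType.
Implicit Types (F G H T : sgraph V) (x y : V).

Lemma eq_set2 (x y z w : V) :
  ([set x; y] == [set z; w]) = ((x == z) && (y == w)) || ((x == w) && (y == z)).
Proof.
apply/eqP/idP => [e|/orP [] /andP [/eqP -> /eqP ->]] //; last by rewrite setUC.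
have := set21 x y; have := set22 x y; have := set21 z w; have := set22 z w.
rewrite {1 2}e -{1 2}e !inE.
by do 4![case/orP => /eqP ?]; subst; rewrite ?eqxx ?orbT.
Qed.

Lemma mem_edges F x y : ([set x; y] \in edges F) = F x y.
Proof.
rewrite inE; apply/existsP/idP => [[a /existsP [b /andP [ab]]]|xy]; last first.
  by exists x; apply/existsP; exists y; rewrite xy eqxx.
by rewrite eq_set2 => /orP [] /andP [/eqP -> /eqP ->] //; rewrite adj_sym.
Qed.

Lemma connect_symg F : connect_sym F.
Proof. exact/sym_connect_sym/adj_sym. Qed.

Lemma inter_sym F H : symmetric [rel x y | F x y && H x y].
Proof. by move=> x y /=; rewrite (adj_sym F) (adj_sym H). Qed.

Lemma inter_irr F H : irreflexive [rel x y | F x y && H x y].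
Proof. by move=> x /=; rewrite adj_irr. Qed.

Definition inter F H := SGraph (inter_sym F H) (inter_irr F H).

Lemma del_edge_sym F a b : symmetric [rel x y | F x y && ([set x; y] != [set a; b])].
Proof. by move=> x y /=; rewrite adj_sym setUC. Qed.

Lemma del_edge_irr F a b : irreflexive [rel x y | F x y && ([set x; y] != [set a; b])].
Proof. by move=> x /=; rewrite adj_irr. Qed.

Definition del_edge F a b := SGraph (del_edge_sym F a b) (del_edge_irr F a b).

(** The rest of the cycle still joins [y] to [x]. Non-emptiness of [p] excludes the cycle of size 2,
    which returns along the deleted edge. *)
Lemma connect_del_edge F x y p :
  ucycle F (x :: y :: p) -> p != [::] -> connect (del_edge F x y) =2 connect F.
Proof.
rewrite /ucycle /= rcons_path inE negb_or.
move=> /andP [/and3P [xy yp px] /and3P [/andP [xNy xp] yNp _]] p0.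
have yx : connect (del_edge F x y) y x.
  apply/connectP; exists (rcons p x); last by rewrite last_rcons.
  rewrite rcons_path; apply/andP; split.
    apply: (sub_in_path (P := predC1 x) (e := F)) yp; last first.
      rewrite /= eq_sym xNy /=; apply/allP => z zp; apply: contraNneq xp.
      by move=> /= <-.
    move=> z w; rewrite !inE => zx wx zw /=; rewrite zw eq_set2 negb_or !negb_and.
    by rewrite zx wx orbT.
  rewrite /= px eq_set2 eqxx (negPf xNy) andbF andbT /=.
  apply: contraNneq yNp; case: p p0 {yp px xp} => // z p _ /= ly.
  by rewrite -[X in X \in _]ly mem_last.
move=> z w; apply/idP/idP; apply: connect_sub => {}z {}w.
  by move=> /andP [/connect1].
move=> zw; have [|] := boolP (del_edge F x y z w); first exact: connect1.
rewrite /= zw negbK eq_set2 => /orP [] /andP [/eqP -> /eqP ->] //.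
by rewrite (connect_symg (del_edge F x y)).
Qed.

(** This extends a spanning forest of [H] to a spanning tree of [G]. Starting from [G], edges on
    cycles are deleted while [good] is preserved, by induction on the number of adjacent ordered
    pairs. *)
Lemma exists_spanning_tree G H : connected_graph G -> subrel H G ->
  exists2 T, spanning_tree G T & connect (inter T H) =2 connect H.
Proof.
move=> cG HG; pose good T := [/\ subrel T G, connected_graph T
  & connect (inter T H) =2 connect H].
suff: forall m T, (#|[set e : V * V | T e.1 e.2]| <= m)%N -> good T ->
    exists2 T', good T' & acyclic T'.
  move=> /(_ _ G (leqnn _)) []; last by move=> T [TG cT TH] aT; exists T.
  split=> // x y; apply: eq_connect => z w /=; apply/andP/idP => [[]//|zw].
  by split=> //; exact: HG.
elim=> [|m IHm] T Tm gT.
  exists T => // -[|x [|y c]] // /andP [/= /andP [xy _] _].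
  by move: Tm; rewrite leqn0 cards_eq0 => /eqP/setP/(_ (x, y)); rewrite !inE /= xy.
have [aT|] := pselect (acyclic T); first by exists T.
move=> /existsNP [c /not_implyP [uc /negP]]; rewrite -ltnNge => c2.
(* If some edge of the cycle is outside H, delete it; otherwise any edge of the
   cycle can be deleted without changing the connectivity of the part in H. *)
suff [x [y [gT' xy]]] : exists x y, good (del_edge T x y) /\ T x y.
  apply: (IHm _ _ gT'); rewrite -ltnS (leq_trans _ Tm) //; apply: proper_card.
  apply/properP; split; first by apply/subsetP => e; rewrite !inE => /andP [].
  by exists (x, y); rewrite !inE //= xy eqxx.
have good_del x y p : ucycle T (x :: y :: p) -> p != [::] ->
    connect (inter (del_edge T x y) H) =2 connect H -> good (del_edge T x y) /\ T x y.
  case: gT => TG cT _ ucp p0 conH; split; last by case/andP: ucp => /andP [].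
  split=> //; first by move=> z w /andP [/TG].
  by move=> z w; rewrite (connect_del_edge ucp).
have [_ _ TH] := gT.
have [cH|ncH] := boolP (cycle H c).
  case: c uc c2 cH => [|x [|y [|z c]]] // uc _ cH; exists x, y.
  apply: (good_del _ _ (z :: c)) => // v w; rewrite -TH.
  have uc' : ucycle (inter T H) (x :: y :: z :: c).
    have [cT u] := andP uc; apply/andP; split=> //.
    apply: cycle_from_next => // a ac /=.
    by rewrite (next_cycle cT) // (next_cycle cH).
  rewrite -(connect_del_edge uc') //; apply: eq_connect => a b /=.
  by rewrite -!andbA; congr (_ && _); rewrite andbC.
have [cT u] := andP uc.
have /hasP [x xc xH] : has (fun x => ~~ H x (next c x)) c.
  rewrite has_predC; apply: contra ncH => /allP xH; exact: cycle_from_next.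
(* Rotating the cycle puts the edge outside [H] first, where [connect_del_edge] deletes it. *)
have [i c' rc] := rot_to xc.
have : size (rot i c) = size c by rewrite size_rot.
have ucr : ucycle T (rot i c) by rewrite rot_ucycle.
rewrite -(next_rot i u) in xH; rewrite rc in xH ucr *.
case: c' {rc} xH ucr => [|y [|z p]] xH ucr sc; rewrite -sc // in c2.
exists x, y; apply: good_del ucr _ _ => // v w.
rewrite -TH; apply: eq_connect => a b /=; rewrite -andbA; congr (_ && _).
case Hab: (H a b); rewrite ?andbF // andbT; apply/negP => /eqP e.
move: xH; rewrite /= eqxx -mem_edges -e mem_edges Hab //.
Qed.

(** Take for [rk v] the distance from the root of the component to [v], and for [par v] the vertex
    before [v] on a shortest such path. *)
Lemma exists_parent F : exists (rk : V -> nat) (par : V -> V), forall v,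
  fingraph.root F v != v -> F (par v) v && (rk (par v) < rk v)%N.
Proof.
pose ro := fingraph.root F.
have ex v : exists n, [exists t : n.-tuple V, path F (ro v) t && (last (ro v) t == v)].
  have : connect F (ro v) v by rewrite connect_symg; exact: connect_root.
  case/connectP => p pp e; exists (size p); apply/existsP; exists (in_tuple p).
  by rewrite pp -e eqxx.
pose rk v := ex_minn (ex v); exists rk.
suff par v : exists u, ro v != v -> F u v && (rk u < rk v)%N.
  by have [p pP] := boolp.choice par; exists p.
have [_|rv] := eqVneq (ro v) v; first by exists v.
have : [exists t : (rk v).-tuple V, path F (ro v) t && (last (ro v) t == v)].
  by rewrite /rk; case: ex_minnP.
have rk_le u p : path F (ro u) p -> last (ro u) p = u -> (rk u <= size p)%N.
  move=> pp lp; rewrite /rk; case: ex_minnP => n _; apply.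
  by apply/existsP; exists (in_tuple p); rewrite pp lp eqxx.
move=> /existsP [[p /= /eqP sp]]; move: sp.
case/lastP: p => [|p w] sp; first by rewrite /= (negPf rv).
rewrite last_rcons rcons_path => /andP [/andP [pp Fw] /eqP wv].
exists (last (ro v) p) => _; rewrite -{2}wv Fw -sp size_rcons ltnS.
have ru : ro (last (ro v) p) = ro v.
  apply/eqP; rewrite /ro root_connect; last exact: connect_symg.
  rewrite connect_symg; apply: (connect_trans (connect_root F v)).
  by apply/connectP; exists p.
by apply: rk_le; rewrite ru.
Qed.

(** Each component has exactly one root, so the cardinality of this set is the rank of [F]. *)
Definition nonroots F := [set v | fingraph.root F v != v].

(** Send a non-root to the edge towards its parent. Two vertices sharing that edge would be parents
    of each other, but [rk] decreases towards the parent. *)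
Lemma card_nonroots_le_edges F : (#|nonroots F| <= #|edges F|)%N.
Proof.
have [rk [par parP]] := exists_parent F.
have inj : {in nonroots F &, injective (fun v => [set par v; v])}.
  move=> v w; rewrite !inE => /parP /andP [_ rv] /parP /andP [_ rw] /eqP.
  rewrite eq_set2 => /orP [/andP [_ /eqP //]|/andP [/eqP pv /eqP vp]].
  by move: rv rw; rewrite pv -vp => /ltn_trans h /h; rewrite ltnn.
rewrite -(card_in_imset inj); apply/subset_leq_card/subsetP => _ /imsetP [v + ->].
by rewrite inE mem_edges => /parP /andP [].
Qed.

Lemma eq_nonroots F H : connect F =2 connect H -> nonroots F = nonroots H.
Proof.
move=> FH; apply/setP => v; rewrite !inE /fingraph.root.
by rewrite (eq_pick (FH v)).
Qed.

(** * Colour classes of an edge colouring *)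

Variables (G : sgraph V) (r : nat) (f : {ffun edge G -> 'I_r}).

Definition colour_rel i x y := [exists e : edge G, (f e == i) && (val e == [set x; y])].

Lemma colour_relP i x y :
  reflect (exists e : edge G, f e = i /\ val e = [set x; y]) (colour_rel i x y).
Proof.
apply: (iffP existsP) => -[e]; first by move=> /andP [/eqP ? /eqP ?]; exists e.
by move=> [fe ee]; exists e; rewrite fe ee !eqxx.
Qed.

Lemma colour_rel_sub i : subrel (colour_rel i) G.
Proof. by move=> x y /colour_relP [e [_ exy]]; rewrite -mem_edges -exy (valP e). Qed.

Lemma colour_rel_sym i : symmetric (colour_rel i).
Proof. by move=> x y; rewrite /colour_rel; apply: eq_existsb => e; rewrite setUC. Qed.

Lemma colour_rel_irr i : irreflexive (colour_rel i).
Proof. by move=> x; apply: contraFF (adj_irr G x); exact: colour_rel_sub. Qed.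

Definition colour_graph i := SGraph (colour_rel_sym i) (colour_rel_irr i).

Lemma colour_graphP x y : G x y -> exists i, colour_graph i x y.
Proof.
rewrite -mem_edges => xy; exists (f (Sub [set x; y] xy)).
by apply/colour_relP; exists (Sub [set x; y] xy); rewrite SubK.
Qed.

(** The tree is chosen so that its edges of colour [i] have the same components as the whole colour
    class, hence number at least its rank. *)
Lemma spanning_tree_colour i : connected_graph G -> exists2 T, spanning_tree G T &
  (#|nonroots (colour_graph i)| <= #|[set e : edge G | (f e == i) && (val e \in edges T)]|)%N.
Proof.
have HG : subrel (colour_graph i) G by exact: colour_rel_sub.
move=> cG; have [T GT TH] := exists_spanning_tree cG HG.
exists T => //; rewrite -(eq_nonroots TH) (leq_trans (card_nonroots_le_edges _)) //.
rewrite -[X in (_ <= X)%N](card_imset _ val_inj); apply/subset_leq_card/subsetP => e.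
rewrite inE => /existsP [x /existsP [y /andP [/andP [xT /colour_relP [a [fa ae]]] /eqP ->]]].
by rewrite -ae; apply: imset_f; rewrite inE fa eqxx ae mem_edges.
Qed.

End SpanningTrees.

(** * Ranks of the colour classes *)

Section ColourRanks.
Variables (V : finType) (G : sgraph V) (d r : nat) (H : 'I_r -> sgraph V).
Hypotheses (d3 : (3 <= d)%N) (Gd : regular G d).
Hypothesis expG : forall S : {set V}, (2 * #|S| * (#|V| - #|S|) <= #|V| * cut G S)%N.
Hypothesis HG : forall i, subrel (H i) G.
Hypothesis Hcover : forall x y, G x y -> exists i, H i x y.
Hypothesis n_large : (2 * d * d.+1 < #|V|)%N.
Local Open Scope nat_scope.

Definition component (F : sgraph V) v := [set u | connect F v u].

Definition has_colour i v := [exists u, H i v u].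

Definition mixed := [set v | [exists i, exists j, [&& i != j, has_colour i v & has_colour j v]]].

Lemma eq_component (F : sgraph V) u v : u \in component F v -> component F u = component F v.
Proof.
rewrite inE => vu; apply/setP => w; rewrite !inE.
by rewrite (same_connect (connect_symg F) vu).
Qed.

Lemma component_refl (F : sgraph V) v : v \in component F v.
Proof. by rewrite inE. Qed.

Lemma sum_comp_leq (F : sgraph V) (a b : V -> nat) :
  (forall x, \sum_(v in component F x) a v <= \sum_(v in component F x) b v) ->
  \sum_v a v <= \sum_v b v.
Proof.
move=> ab; pose ro := fingraph.root F.
have roK v : ro (ro v) == ro v by rewrite /ro root_root //; exact: connect_symg.
rewrite [leqLHS](partition_big ro (fun x => ro x == x)) //=.
rewrite [leqRHS](partition_big ro (fun x => ro x == x)) //=.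
apply: leq_sum => x /eqP rx.
have E v : (ro v == x) = (v \in component F x).
  by rewrite inE -(root_connect (connect_symg F)) -/ro rx eq_sym.
by rewrite !(eq_bigl _ _ E).
Qed.

Lemma comp_nonroots (F : sgraph V) x :
  \sum_(v in component F x) (v \in nonroots F) = #|component F x|.-1.
Proof.
pose ro := fingraph.root F.
have rC : ro x \in component F x by rewrite inE connect_root.
rewrite (bigD1 (ro x)) //= inE /ro root_root ?eqxx; last exact: connect_symg.
rewrite add0n -sum1_card [in RHS](bigD1 (ro x)) //=; apply: eq_bigr => v /andP [].
rewrite !inE => xv; have rv : fingraph.root F v = fingraph.root F x.
  by apply/eqP; rewrite eq_sym root_connect //; exact: connect_symg.
by rewrite rv eq_sym => ->.
Qed.

Lemma has_colourE i v : has_colour i v = (1 < #|component (H i) v|).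
Proof.
apply/existsP/idP => [[u vu]|].
  rewrite (cardsD1 v) component_refl (cardsD1 u) !inE connect1 //.
  by rewrite andbT; case: eqP vu => // ->; rewrite adj_irr.
rewrite (cardsD1 v) component_refl ltnS card_gt0 => /set0Pn [w].
rewrite !inE => /andP [wv /connectP [[|u p] /=]]; first by move=> _ e; rewrite e eqxx in wv.
by move=> /andP [vu _] _; exists u.
Qed.

Lemma not_mixed_colour i j v : v \notin mixed -> has_colour i v -> has_colour j v -> i = j.
Proof.
move=> vW hi hj; apply/eqP; apply: contraNT vW => ij; rewrite inE.
by apply/existsP; exists i; apply/existsP; exists j; rewrite ij hi.
Qed.

Lemma not_mixed_nbr i x y : x \notin mixed -> has_colour i x -> G x y -> H i x y.
Proof.
move=> xW hi /Hcover [j xy]; rewrite (not_mixed_colour xW hi (j := j)) //.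
by apply/existsP; exists y.
Qed.

Lemma has_colour_comp i u v : u \in component (H i) v -> has_colour i u = has_colour i v.
Proof. by move=> /eq_component; rewrite !has_colourE => ->. Qed.

Lemma nbr_comp i x v y : x \in component (H i) v -> H i x y -> y \in component (H i) v.
Proof. by rewrite !inE => vx /connect1; exact: connect_trans. Qed.

(** An unmixed vertex keeps all its neighbours inside the component; a mixed one keeps at least one,
    its neighbour in colour [i]. *)
Lemma cut_comp i v : has_colour i v ->
  cut G (component (H i) v) <= #|component (H i) v :&: mixed| * d.-1.
Proof.
set C := component _ _ => hv; rewrite /cut (big_setID mixed) /= [X in _ + X]big1 ?addn0.
  rewrite -sum_nat_const; apply: leq_sum => x /setIP [xC _].
  have : has_colour i x by rewrite (has_colour_comp xC).
  case/existsP => u xu; have d1 : d.-1.+1 = d by lia.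
  rewrite -ltnS d1 -(Gd x).
  apply: proper_card; apply/properP; split.
    by apply/subsetP => y; rewrite !inE => /andP [].
  exists u; rewrite !inE ?(HG xu) //=; apply/negPn.
  by have := nbr_comp xC xu; rewrite inE.
move=> x /setDP [xC xW]; apply/eqP; rewrite cards_eq0; apply/eqP/setP => y.
rewrite in_set0 inE; apply/negbTE/negP => /andP [/(not_mixed_nbr xW) xy].
by rewrite (nbr_comp xC) // xy // (has_colour_comp xC).
Qed.

(** * Weights when all monochromatic components are small *)

Section SmallComponents.
Hypothesis small : forall i v, 4 * #|component (H i) v| < 3 * #|V|.

(** Let c be the size of the component. Since n - c > n/4, expansion gives at least c/2 edges
    leaving it, and [cut_comp] bounds these by d - 1 per mixed vertex. *)
Lemma card_comp_le i v : has_colour i v ->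
  #|component (H i) v| <= 2 * d.-1 * #|component (H i) v :&: mixed|.
Proof.
move=> hv; have := expG (component (H i) v); have := cut_comp hv; have := small i v.
set c := #|component _ _|; set w := #|_ :&: _|; set n := #|V|; set e := cut _ _.
move=> cn ew ce; have n0 : 0 < n by lia.
rewrite -(leq_pmul2l n0).
have h1 : n * e <= n * (w * d.-1) by rewrite leq_mul2l ew orbT.
have h2 : c * n <= c * (4 * (n - c)) by rewrite leq_mul2l; apply/orP; right; lia.
move: (n - c) h1 h2 ce => m; lia.
Qed.

(* A component with an unmixed vertex contains its whole neighbourhood, so it has
   at least d + 1 vertices; with at most two mixed vertices its edge boundary is at
   most 2 (d - 1), which contradicts the expansion. *)
Lemma mixed_comp i v : has_colour i v ->
  3 <= #|component (H i) v :&: mixed| \/ component (H i) v \subset mixed.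
Proof.
move=> hv; have [CW|/subsetPn [x xC xW]] := boolP (component (H i) v \subset mixed); first by right.
left; rewrite leqNgt; apply/negP; rewrite ltnS => w2.
have hx : has_colour i x by rewrite (has_colour_comp xC).
have dC : d < #|component (H i) v|.
  rewrite (cardsD1 x) xC ltnS -(Gd x); apply/subset_leq_card/subsetP => y.
  rewrite !inE => xy; have yC := nbr_comp xC (not_mixed_nbr xW hx xy).
  by rewrite inE in yC; rewrite yC andbT; case: eqP xy => // ->; rewrite adj_irr.
have := card_comp_le hv; have := expG (component (H i) v); have := cut_comp hv.
have := small i v; move: dC w2 n_large.
set c := #|component _ _|; set w := #|_ :&: _|; set n := #|V|; set e := cut _ _.
move=> dc w2 nl cn ew ce cw.
have e2 : e <= 2 * d.-1 by apply: (leq_trans ew); rewrite leq_mul2r w2 orbT.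
have c4 : c <= 4 * d.-1 by apply: (leq_trans cw); nia.
have h1 : n * e <= n * (2 * d.-1) by rewrite leq_mul2l e2 orbT.
have h2 : d.+1 * (n - 4 * d.-1) <= c * (n - c) by apply: leq_mul => //; lia.
have : d.+1 * (n - 4 * d.-1) <= n * d.-1 by lia.
(* The inequality yields n <= 2(d - 1)(d + 1), against [n_large]. *)
by move: nl d3; clear; nia.
Qed.

Definition weight i v :=
  if ~~ has_colour i v then 0 else
  if v \in mixed then 3 + (2 < #|component (H i) v|) else 6.

(** With c vertices, w >= 3 of them mixed, the total is 4w + 6(c - w) = 6c - 2w <= 6(c - 1). If all
    are mixed it is 6 for c = 2, and 4c <= 6(c - 1) for c >= 3. *)
Lemma weight_comp i x : \sum_(v in component (H i) x) weight i v <= 6 * #|component (H i) x|.-1.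
Proof.
have [hx|hx] := boolP (has_colour i x); last first.
  by rewrite big1 // => v vx; rewrite /weight (has_colour_comp vx) hx.
have c1 := hx; rewrite has_colourE in c1.
rewrite (big_setID mixed) /=.
rewrite (eq_bigr (fun=> 3 + (2 < #|component (H i) x|))); last first.
  by move=> v /setIP [vC vW]; rewrite /weight (has_colour_comp vC) hx vW (eq_component vC).
rewrite [X in _ + X](eq_bigr (fun=> 6)); last first.
  by move=> v /setDP [vC vW]; rewrite /weight (has_colour_comp vC) hx (negPf vW).
rewrite !sum_nat_const; have := cardsID mixed (component (H i) x).
have [w3|CW] := mixed_comp hx; last first.
  by rewrite (setIidPl CW) => e; case: ltngtP c1; lia.
have : #|component (H i) x :&: mixed| <= #|component (H i) x| by apply/subset_leq_card/subsetIl.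
by move=> h e; rewrite (_ : 2 < _ = true); lia.
Qed.

Lemma sum_weight_nonroots i : \sum_v weight i v <= 6 * #|nonroots (H i)|.
Proof.
rewrite -sum1_card [in leqRHS]big_mkcond big_distrr /=.
rewrite [leqRHS](eq_bigr (fun v => 6 * (v \in nonroots (H i)))); last first.
  by move=> v _; case: (v \in _).
by apply: (sum_comp_leq (F := H i)) => x; rewrite -big_distrr /= comp_nonroots weight_comp.
Qed.

(** Every neighbour of [v] is a further vertex of some monochromatic component of [v]. *)
Lemma degree_le_sum v : d <= \sum_i #|component (H i) v|.-1.
Proof.
rewrite -(Gd v) -sum1_card big_mkcond /=.
apply: (@leq_trans (\sum_i \sum_y H i v y)).
  rewrite exchange_big /=; apply: leq_sum => y _; rewrite inE; case: ifP => // /Hcover [i vy].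
  by rewrite (bigD1 i) //= vy.
apply: leq_sum => i _; rewrite (cardsD1 v) component_refl /= -sum1_card [leqRHS]big_mkcond /=.
apply: leq_sum => y _; case vy: (H i v y) => //.
by rewrite !inE connect1 // andbT; case: eqP vy => // ->; rewrite adj_irr.
Qed.

Lemma sum_weight_colours v : 6 + (v \in mixed) <= \sum_i weight i v.
Proof.
have [vW|vW] := boolP (v \in mixed); last first.
  have : 0 < #|[set y | G v y]| by rewrite Gd; lia.
  rewrite card_gt0 => /set0Pn [y]; rewrite inE => /Hcover [i vy].
  have hi : has_colour i v by apply/existsP; exists y.
  by rewrite (bigD1 i) //= {1}/weight hi (negPf vW).
have := vW; rewrite inE => /existsP [i /existsP [j /and3P [ij hi hj]]].
have := degree_le_sum v; rewrite (bigD1 i) //= (bigD1 j) 1?eq_sym //=.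
rewrite [X in _ -> _ <= X](bigD1 i) //= [X in _ -> _ <= _ + X](bigD1 j) 1?eq_sym //=.
rewrite {1 2}/weight hi hj vW /=; set S := (X in _ -> _ <= _ + (_ + X)).
(* If no third colour meets [v], then [degree_le_sum] and d >= 3 give one of the two components more
   than two vertices, so the weights are at least 3 and 4. *)
have [S0|] := posnP S; last by lia.
rewrite [X in _ + (_ + X)]big1; first by rewrite S0; lia.
move=> k kij; move/eqP: S0; rewrite sum_nat_eq0 => /forallP /(_ k) /implyP /(_ kij).
by rewrite /weight vW has_colourE; case: ltnP => //=; case: #|_| => [|[]].
Qed.

(** Every vertex lies in a nontrivial component of some colour; [card_comp_le] is summed over these
    components and then over the colours. *)
Lemma card_le_mixed : #|V| <= 2 * d * r * #|mixed|.
Proof.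
apply: (@leq_trans (\sum_(i < r) \sum_v has_colour i v)).
  rewrite exchange_big /= -sum1_card; apply: leq_sum => v _.
  have : 0 < #|[set y | G v y]| by rewrite Gd; lia.
  rewrite card_gt0 => /set0Pn [y]; rewrite inE => /Hcover [i vy].
  by rewrite (bigD1 i) //= (_ : has_colour i v) //; apply/existsP; exists y.
apply: (@leq_trans (\sum_(i < r) 2 * d.-1 * #|mixed|)); last first.
  rewrite sum_nat_const card_ord; have : d.-1 <= d by lia.
  by move: (d.-1) => k kd; rewrite mulnCA mulnA leq_mul2r; apply/orP; right; nia.
apply: leq_sum => i _; rewrite -sum1_card [in leqRHS]big_mkcond big_distrr /=.
rewrite [leqRHS](eq_bigr (fun v => 2 * d.-1 * (v \in mixed))); last by move=> v _; case: (v \in _).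
apply: (sum_comp_leq (F := H i)) => x; rewrite -big_distrr /=.
have [hx|hx] := boolP (has_colour i x); last first.
  by rewrite big1 // => v vC; rewrite (has_colour_comp vC) (negPf hx).
rewrite (eq_bigr (fun=> 1)); last by move=> v vC; rewrite (has_colour_comp vC) hx.
rewrite sum1_card (leq_trans (card_comp_le hx)) // leq_mul2l; apply/orP; right.
rewrite -sum1_card [leqRHS](big_setID mixed) /=.
rewrite [X in _ <= X + _](eq_bigr (fun=> 1)) ?leq_addr //.
by move=> v /setIP [_ ->].
Qed.

End SmallComponents.

(** With small components, n + #mixed/6 and [card_le_mixed] bound the sum of the ranks below by (1 +
    1/(12dr)) n, and some colour reaches the average over the r colours. *)
Lemma large_colour_rank : 2 <= r ->
  exists i, (12 * d * r + 1) * #|V| <= 12 * d * r * r * #|nonroots (H i)|.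
Proof.
move=> r2; have [small|] := pselect (forall i v, 4 * #|component (H i) v| < 3 * #|V|).
  apply: contrapT => /forallNP no.
  have tot : 6 * #|V| + #|mixed| <= 6 * \sum_i #|nonroots (H i)|.
    apply: (@leq_trans (\sum_i \sum_v weight i v)); last first.
      rewrite big_distrr /=; apply: leq_sum => i _; exact: sum_weight_nonroots.
    rewrite exchange_big /=; apply: (@leq_trans (\sum_v (6 + (v \in mixed)))).
      rewrite big_split /= sum_nat_const -[#|mixed|]sum1_card [\sum_(i in mixed) _]big_mkcond /=.
      rewrite mulnC leq_add2l; apply: leq_sum => v _; by case: (v \in _).
    by apply: leq_sum => v _; exact: sum_weight_colours.
  have : \sum_(i < r) (12 * d * r * r * #|nonroots (H i)|).+1 <=
      \sum_(i < r) (12 * d * r + 1) * #|V|.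
    by apply: leq_sum => i _; rewrite ltnNge; apply/negP; exact: no.
  rewrite sum_nat_const card_ord; under eq_bigr do rewrite -addn1.
  rewrite big_split /= sum_nat_const card_ord -big_distrr /= muln1.
  have := card_le_mixed small; move: tot.
  set s := \sum_i _; set w := #|mixed|; set n := #|V| => tot nw.
  have : 2 * d * r * r * (6 * n + w) <= 2 * d * r * r * (6 * s) by rewrite leq_mul2l tot orbT.
  have : r * n <= r * (2 * d * r * w) by rewrite leq_mul2l nw orbT.
  by move=> *; lia.
move=> /existsNP [i /existsNP [v /negP]]; rewrite -leqNgt => big; exists i.
have : #|component (H i) v|.-1 <= #|nonroots (H i)|.
  rewrite -comp_nonroots -[leqRHS]sum1_card [leqRHS]big_mkcond /=.
  rewrite [leqRHS](bigID (mem (component (H i) v))) /=.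
  apply: (leq_trans _ (leq_addr _ _)).
  by apply: leq_sum => u _; case: (u \in _).
have nl := n_large; set k := #|nonroots _|; set n := #|V| in big nl *.
move=> ck; have n8 : 8 <= n by nia.
(* The rank is at least 3n/4 - 1 >= 5n/8, so r times it is at least 5n/4, which suffices as 12dr >=
   4. *)
have nk : 5 * n <= 8 * k by lia.
have rk : 2 * k <= r * k by rewrite leq_mul2r r2 orbT.
rewrite -[12 * d * r * r * k]mulnA; move: (r * k) rk => q rk.
have : 4 <= 12 * d * r by nia.
move: (12 * d * r) => m m4; clear -nk rk m4.
have h1 : m * (5 * n) <= m * (4 * q) by rewrite leq_mul2l; apply/orP; right; lia.
have h2 : 4 * n <= m * n by rewrite leq_mul2r m4 orbT.
lia.
Qed.

End ColourRanks.

(** * Connectedness and the two linear bounds *)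

(** No edge leaves a component, so expansion leaves no vertex outside it. This supplies the spanning
    trees. *)
Lemma expansion_connected (V : finType) (G : sgraph V) :
  (forall S : {set V}, 2 * #|S| * (#|V| - #|S|) <= #|V| * cut G S)%N ->
  connected_graph G.
Proof.
move=> expG x y; have := expG (component G x); rewrite [cut _ _]big1; last first.
  move=> u; rewrite inE => xu; apply/eqP; rewrite cards_eq0; apply/eqP/setP => v.
  rewrite in_set0 !inE; apply/negbTE/negP => /andP [uv /negP]; apply.
  exact: connect_trans (connect1 uv).
have C0 : (0 < #|component G x|)%N by apply/card_gt0P; exists x; rewrite component_refl.
rewrite muln0 leqn0 !muln_eq0 /= eqn0Ngt C0 /= subn_eq0 => CV.
have : component G x = setT by apply/eqP; rewrite eqEcard subsetT cardsT.
by move/setP/(_ y); rewrite !inE.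
Qed.

(** Edges are images of adjacent ordered pairs; the lost factor 2 only affects the constant. *)
Lemma card_edge_le (V : finType) (G : sgraph V) d :
  regular G d -> (#|{: edge G}| <= d * #|V|)%N.
Proof.
move=> Gd; rewrite card_sig.
have -> : #|[pred A | A \in edges G]| = #|edges G| by apply: eq_card.
pose P := [set p : V * V | G p.1 p.2].
apply: (@leq_trans #|P|).
  apply: leq_trans (leq_imset_card (fun p => [set p.1; p.2]) _).
  apply/subset_leq_card/subsetP => A; rewrite inE.
  move=> /existsP [x /existsP [y /andP [xy /eqP ->]]].
  by apply/imsetP; exists (x, y) => //; rewrite inE.
rewrite -sum1_card mulnC -sum_nat_const.
rewrite (eq_bigl (fun p => G p.1 p.2)); last by move=> p; rewrite inE.
rewrite -(pair_big_dep xpredT G (fun _ _ => 1%N)) /=.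
by apply: leq_sum => x _; rewrite sum1_card -(Gd x) cardsE.
Qed.

Theorem corollary1p7 (R : realType) (r d : nat)
    (hr : (2 <= r)%N) (hd : (3 <= d)%N) :
  exists (c1 c2 : R) (n0 : nat),
    [/\ 0 < c1, 0 < c2 &
      forall (V : finType) (G : sgraph V),
        regular G d -> lambda2 R G <= d%:R - 2 -> (n0 <= #|V|)%N ->
        c1 * #|V|%:R <= discrepancy R G r <= c2 * #|V|%:R].
Proof.
have r0 : 0 < r%:R :> R by rewrite ltr0n; lia.
have d0 : 0 < d%:R :> R by rewrite ltr0n; lia.
(* The discrepancy of [T] is r max - (n - 1). The lower constant is the surplus in
   [large_colour_rank], the upper one comes from max <= dn, and the threshold is that of
   [n_large]. *)
exists (12 * d%:R * r%:R)^-1, (r%:R * d%:R), (2 * d * d.+1).+1.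
split; rewrite ?invr_gt0 ?mulr_gt0 // => V G Gd l2 nV.
have expG S := expansion Gd S l2; have cG := expansion_connected expG.
have n1 : 1 <= #|V|%:R :> R by rewrite ler1n; lia.
have disc_le (f : {ffun edge G -> 'I_r}) T : tree_disc R f T <= r%:R * d%:R * #|V|%:R.
  rewrite -mulrA ler_pM2l // lerBlDr (@le_trans _ _ (d%:R * #|V|%:R)) //.
    rewrite -natrM ler_nat; apply/bigmax_leqP => i _.
    by rewrite (leq_trans (max_card _)) // card_edge_le.
  by rewrite lerDl divr_ge0 ?ler0n ?subr_ge0.
have sup_ge (f : {ffun edge G -> 'I_r}) : (12 * d%:R * r%:R)^-1 * #|V|%:R <=
    sup [set tree_disc R f T | T in spanning_tree G]%classic.
  have Hsub i : subrel (colour_graph f i) G by exact: colour_rel_sub.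
  have [i hi] := large_colour_rank hd Gd expG Hsub (@colour_graphP _ _ _ f) nV hr.
  have [T GT rT] := spanning_tree_colour f i cG.
  apply: (@le_trans _ _ (tree_disc R f T)); last first.
    apply: ub_le_sup; last by exists T.
    by exists (r%:R * d%:R * #|V|%:R) => _ [T' _ <-].
  rewrite /tree_disc; set m := \max_(_ < r) _.
  have km : (#|nonroots (colour_graph f i)| <= m)%N.
    by apply: (leq_trans rT); rewrite /m; exact: (leq_bigmax_cond i).
  have {}hi : ((12 * d * r + 1) * #|V| <= 12 * d * r * r * m)%N.
    by apply: (leq_trans hi); rewrite leq_mul2l km orbT.
  move: hi; rewrite -(ler_nat R) !(natrM, natrD) => hi.
  rewrite [X in _ <= X]mulrBr [X in _ <= _ - X]mulrC divfK ?gt_eqF //.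
  rewrite mulrC ler_pdivrMr ?mulr_gt0 //.
  set q := 12 * d%:R * r%:R in hi *; have q0 : 0 < q by rewrite !mulr_gt0.
  by move: hi q0; clear; lra.
have f0 : {ffun edge G -> 'I_r} by apply: [ffun=> Ordinal (ltnW hr)].
apply/andP; split.
  apply: lb_le_inf => [|_ [f _ <-] //].
  by exists (sup [set tree_disc R f0 T | T in spanning_tree G]%classic), f0.
apply: (@le_trans _ _ (sup [set tree_disc R f0 T | T in spanning_tree G]%classic)).
  apply: ge_inf; last by exists f0.
  by exists ((12 * d%:R * r%:R)^-1 * #|V|%:R) => _ [f _ <-].
(* Taking [H = G] provides some spanning tree, so that the supremum is over a nonempty set. *)
have GG : subrel G G by [].
have [T GT _] := exists_spanning_tree cG GG.
apply: ge_sup; first by exists (tree_disc R f0 T), T.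
by move=> _ [T' _ <-].
Qed.
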